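(* Let $q^*(\cdot)$ be the user choice function and $\hat\theta$ the marginal user under the ISP's optimal service differentiation, in the fixed capacity scenario with $0<C_M<\bar C$ or in the variable capacity scenario with convex cost function, as characterized in the context. Then under the ISP's optimal service differentiation the service classes form an interval $\mathcal{Q}^*=[q^*(1),q^*(\hat\theta)]$, and the associated prices satisfy $$p^*(q)=\vartheta\, v(q)-\int_0^{\vartheta}v(q^*(s))\,\mathrm{d}s,\qquad\forall q\in\mathcal{Q}^*,$$ where $\vartheta$ is the user type such that $q^*(\vartheta)=q$. Furthermore, $p^*(\cdot)$ is continuously differentiable and decreasing in $q$.
   Context: Users have types $\theta\in[0,1]$ distributed with density $f$ (continuously differentiable and strictly positive on $[0,1]$) and CDF $F$. The function $v:[0,1]\to\mathbb{R}_+$ is continuously differentiable and strictly decreasing with $v(0)=1$, $v(1)=0$. The function $w:[0,1]\to\mathbb{R}_+$ is continuously differentiable and decreasing with $w(1)=0$. A strategy (service differentiation) of the ISP is a pair $(\mathcal{Q},p)$, where $\mathcal{Q}\subseteq[0,1]$ is the set of offered congestion levels (service classes) and $p:\mathcal{Q}\to\mathbb{R}_+$ gives prices; users may always choose the dummy class $q=1$ with $p(1)=0$ (opting out). The user choice function satisfies $q(\theta)\in\arg\max_{q\in\mathcal{Q}}\theta v(q)-p(q)$. Total capacity consumption is $W(1)=\int_0^1 w(q(\theta))f(\theta)\,\mathrm{d}\theta$ and revenue is $\int_0^1p(q(\theta))f(\theta)\,\mathrm{d}\theta$. Fixed capacity scenario: maximize revenue subject to $W(1)\le C_M$. Variable capacity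 scenario: maximize revenue minus $S(W(1))$, where $S:[0,+\infty)\to\mathbb{R}$ is a nondecreasing, differentiable, convex function with $S(0)=0$. Assumptions: the virtual valuation $G(\theta)\triangleq\theta-\frac{1-F(\theta)}{f(\theta)}$ has a unique zero $\theta_0$ in $(0,1)$ and is strictly increasing on $(\theta_0,1)$; $G^{-1}$ denotes the inverse of $G$ restricted to $[\theta_0,1]$. The virtual capacity $h(q)\triangleq w'(q)/v'(q)$ (with $v'\ne0$ on $(0,1)$) is strictly decreasing on $(0,1)$, with one-sided limits $h(0)\in(0,+\infty]$, $h(1)\in[0,+\infty)$; $h^{-1}$ on $[h(1),+\infty)$ is the inverse of $h$ on $[h(1),h(0)]$ and $0$ on $(h(0),+\infty)$. Put $\bar C\triangleq[1-F(\theta_0)]w(0)$. Characterization of the optimum: $q^*(\theta)=1$ for $\theta\in[0,\hat\theta)$, $q^*(\theta)=h^{-1}(G(\theta)/\kappa)$ for $\theta\in[\hat\theta,1]$, $\hat\theta=G^{-1}(\kappa h(1))$, where in the fixed capacity scenario ($0<C_M<\bar C$) $\kappa=\mu>0$ is the unique constant for which $\int_0^1w(q^*(\theta))f(\theta)\,\mathrm{d}\theta=C_M$, and in the variable capacity scenario $\kappa=S'(W^*(1))$ where $W^*(1)$ is uniquely determined by $\int_0^1w(q^*(\theta))f(\theta)\,\mathrm{d}\theta=W^*(1)$. Conventions for degenerate cases: $x/0=+\infty$ for $x\ge0$, $h^{-1}(+\infty)=0$, $G^{-1}(x)=1$ for $x>1$, $h^{-1}(x)=1$ for $x<h(1)$.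 *)

(* Defs.v *)
(* Stdlib reals with Coquelicot. *)
From Stdlib Require Export Reals ClassicalEpsilon.
From Coquelicot Require Export Coquelicot.

Open Scope R_scope.

(* Functions on [0,1] or [0,+oo) are total functions on R of which only the
   values on the stated domain matter.  Derivatives and continuity on a closed
   domain are therefore taken within that domain ([D_in], [continue_in]), hence
   one-sided at its end points and unconstrained at an isolated point. *)

Definition I01 (x : R) : Prop := 0 <= x <= 1.
Definition nonneg (x : R) : Prop := 0 <= x.

Definition C1_on (D : R -> Prop) (g : R -> R) : Prop :=
  exists dg : R -> R,
    forall x, D x -> D_in g dg D x /\ continue_in dg D x.

Definition decreasing_on (D : R -> Prop) (g : R -> R) : Prop :=
  forall x y, D x -> D y -> x < y -> g y <= g x.

Definition strictly_decreasing_on (D : R -> Prop) (g : R -> R) : Prop :=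
  forall x y, D x -> D y -> x < y -> g y < g x.

Record market : Type := Market {
  density : R -> R;    (* f *)
  val     : R -> R;    (* v *)
  cap     : R -> R     (* w *)
}.

Definition cdf (m : market) (theta : R) : R := RInt (density m) 0 theta.

(* G *)
Definition virtual_valuation (m : market) (theta : R) : R :=
  theta - (1 - cdf m theta) / density m theta.

(* h on the open interval (0,1) *)
Definition virtual_capacity (m : market) (q : R) : R :=
  Derive (cap m) q / Derive (val m) q.

Record market_primitives (m : market) : Prop := {
  density_C1   : C1_on I01 (density m);
  density_pos  : forall x, I01 x -> 0 < density m x;
  density_mass : is_RInt (density m) 0 1 1;
  val_C1       : C1_on I01 (val m);
  val_ge0      : forall x, I01 x -> 0 <= val m x;
  val_decr     : strictly_decreasing_on I01 (val m);
  val_at0      : val m 0 = 1;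
  val_at1      : val m 1 = 0;
  cap_C1       : C1_on I01 (cap m);
  cap_ge0      : forall x, I01 x -> 0 <= cap m x;
  cap_decr     : decreasing_on I01 (cap m);
  cap_at1      : cap m 1 = 0
}.

Record regular_valuation (m : market) (theta0 : R) : Prop := {
  theta0_range : 0 < theta0 < 1;
  theta0_zero  : virtual_valuation m theta0 = 0;
  theta0_uniq  : forall t, 0 < t < 1 -> virtual_valuation m t = 0 -> t = theta0;
  valuation_incr : forall s t, theta0 < s -> s < t -> t < 1 ->
                     virtual_valuation m s < virtual_valuation m t
}.

(* [h0] and [h1] are the one-sided limits h(0), possibly +oo, and h(1). *)
Record regular_capacity (m : market) (h0 : Rbar) (h1 : R) : Prop := {
  dval_neq0 : forall q, 0 < q < 1 -> Derive (val m) q <> 0;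
  capacity_decr : strictly_decreasing_on (fun q => 0 < q < 1) (virtual_capacity m);
  capacity_at0 : filterlim (virtual_capacity m) (at_right 0) (Rbar_locally h0);
  capacity_at1 : filterlim (virtual_capacity m) (at_left 1) (locally h1);
  h0_pos : Rbar_lt (Finite 0) h0;
  h1_ge0 : 0 <= h1
}.

(* h extended to [0,1] by its limits at the end points *)
Definition virtual_capacity_ext (m : market) (h0 : Rbar) (h1 : R) (q : R) : Rbar :=
  if Req_EM_T q 0 then h0
  else if Req_EM_T q 1 then Finite h1
  else Finite (virtual_capacity m q).

(* Both inverses below are meaningful on the ranges of h and G; the remaining
   branches are the stated conventions.  The convention h^{-1}(+oo) = 0 comes
   from the second branch when h(0) is finite, from the third otherwise. *)
Definition virtual_capacity_inv (m : market) (h0 : Rbar) (h1 : R) (x : Rbar) : R :=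
  if Rbar_lt_dec x (Finite h1) then 1
  else if Rbar_lt_dec h0 x then 0
  else epsilon (inhabits 0)
         (fun q => I01 q /\ virtual_capacity_ext m h0 h1 q = x).

Definition virtual_valuation_inv (m : market) (theta0 : R) (x : R) : R :=
  if Rlt_dec 1 x then 1
  else epsilon (inhabits 0)
         (fun theta => theta0 <= theta <= 1 /\ virtual_valuation m theta = x).

(* x / 0 = +oo *)
Definition div_ext (x k : R) : Rbar :=
  if Req_EM_T k 0 then p_infty else Finite (x / k).

Definition marginal_user (m : market) (theta0 h1 kappa : R) : R :=
  virtual_valuation_inv m theta0 (kappa * h1).

Definition optimal_choice (m : market) (theta0 : R) (h0 : Rbar) (h1 kappa : R)
    (theta : R) : R :=
  if Rlt_dec theta (marginal_user m theta0 h1 kappa) then 1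
  else virtual_capacity_inv m h0 h1 (div_ext (virtual_valuation m theta) kappa).

(* The dummy class of users who opt out is counted among the available classes,
   at price 0. *)
Record strategy (Q : R -> Prop) (p : R -> R) : Prop := {
  classes_range : forall q, Q q -> I01 q;
  dummy_class   : Q 1;
  dummy_price   : p 1 = 0;
  price_ge0     : forall q, Q q -> 0 <= p q
}.

Definition user_choice (m : market) (Q : R -> Prop) (p q : R -> R) : Prop :=
  forall theta, I01 theta ->
    Q (q theta) /\
    forall r, Q r -> theta * val m r - p r <= theta * val m (q theta) - p (q theta).

(* For a user choice function q is nonincreasing on [0,1], and p o q is there
   the difference of theta * v(q(theta)) and the (convex, Lipschitz) indirect
   utility, so the two integrands below are Riemann integrable. *)
Definition capacity_used (m : market) (q : R -> R) : R :=
  RInt (fun theta => cap m (q theta) * density m theta) 0 1.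

Definition revenue (m : market) (p q : R -> R) : R :=
  RInt (fun theta => p (q theta) * density m theta) 0 1.

Inductive scenario : Type :=
  | FixedCapacity (CM : R)
  | VariableCapacity (cost : R -> R).

Record cost_function (cost : R -> R) : Prop := {
  cost_at0  : cost 0 = 0;
  cost_incr : forall x y, 0 <= x -> x <= y -> cost x <= cost y;
  cost_diff : forall x, nonneg x -> exists l, D_in cost (fun _ => l) nonneg x;
  cost_convex : forall x y t, nonneg x -> nonneg y -> I01 t ->
      cost (t * x + (1 - t) * y) <= t * cost x + (1 - t) * cost y
}.

Definition admissible_scenario (m : market) (theta0 : R) (sc : scenario) : Prop :=
  match sc with
  | FixedCapacity CM => 0 < CM < (1 - cdf m theta0) * cap m 0
  | VariableCapacity cost => cost_function cost
  end.

Definition feasible (m : market) (sc : scenario)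
    (Q : R -> Prop) (p q : R -> R) : Prop :=
  strategy Q p /\ user_choice m Q p q /\
  match sc with
  | FixedCapacity CM => capacity_used m q <= CM
  | VariableCapacity _ => True
  end.

Definition objective (m : market) (sc : scenario) (p q : R -> R) : R :=
  match sc with
  | FixedCapacity _ => revenue m p q
  | VariableCapacity cost => revenue m p q - cost (capacity_used m q)
  end.

Definition optimal_differentiation (m : market) (sc : scenario)
    (Q : R -> Prop) (p q : R -> R) : Prop :=
  feasible m sc Q p q /\
  forall Q' p' q', feasible m sc Q' p' q' ->
    objective m sc p' q' <= objective m sc p q.

(* The equation determining kappa, given the choice function [q] built from it;
   in the second case kappa is the derivative of the cost
   at the capacity used. *)
Definition capacity_price (m : market) (sc : scenario)
    (q : R -> R) (kappa : R) : Prop :=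
  match sc with
  | FixedCapacity CM => 0 < kappa /\ capacity_used m q = CM
  | VariableCapacity cost => D_in cost (fun _ => kappa) nonneg (capacity_used m q)
  end.

(* The classes taken up by the users from the marginal one upwards; classes on
   offer that no such user takes, and opting out below the marginal user, do not
   count. *)
Definition service_classes (Q : R -> Prop) (q : R -> R) (thetahat r : R) : Prop :=
  Q r /\ exists theta, thetahat <= theta <= 1 /\ q theta = r.

(* Main.v *)
Require Import Defs.
From Stdlib Require Import Lra Lia.

(** The price formula is the envelope theorem: the indirect utility
    [t * v (q t) - p (q t)] has the monotone slope [v (q t)], and it vanishes at
    [t = 0] because prices are nonnegative while the dummy class is free.  A class
    [r] is chosen by the type [t] with [G t = kappa * h r], so monotonicity and the
    intermediate value theorem for [G] make the classes an interval, and the first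
    type choosing [r] depends continuously on [r].  Incentive compatibility then
    squeezes the difference quotients of [p], giving [p' r = t * v' r]. *)

(** * Continuity within a closed interval, by extension to the whole line *)

Definition clamp (a b x : R) : R := Rmax a (Rmin b x).

Lemma clamp_in (a b x : R) : a <= b -> a <= clamp a b x <= b.
Proof.
  intros Hab; unfold clamp, Rmax, Rmin.
  repeat destruct Rle_dec; lra.
Qed.

Lemma clamp_id (a b x : R) : a <= x <= b -> clamp a b x = x.
Proof.
  intros Hx; unfold clamp, Rmax, Rmin.
  repeat destruct Rle_dec; lra.
Qed.

Lemma clamp_lipschitz (a b x y : R) : Rabs (clamp a b x - clamp a b y) <= Rabs (x - y).
Proof.
  unfold clamp, Rmax, Rmin, Rabs.
  repeat destruct Rle_dec; repeat destruct Rcase_abs; lra.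
Qed.

Lemma continue_in_sub (D E : R -> Prop) (f : R -> R) (x : R) :
  (forall y, E y -> D y) -> continue_in f D x -> continue_in f E x.
Proof.
  intros HED; apply limit1_imp.
  intros y [Hy Hne]; split; auto.
Qed.

(** Composing with the 1-Lipschitz retraction onto [[a, b]] turns continuity within the interval
    into continuity on [R], the form required by the intermediate value theorem and by the
    differentiation of integrals. *)
Lemma continuity_clamp (a b : R) (f : R -> R) :
  a <= b -> (forall x, a <= x <= b -> continue_in f (fun y => a <= y <= b) x) ->
  continuity (fun x => f (clamp a b x)).
Proof.
  intros Hab Hf x eps Heps.
  destruct (Hf (clamp a b x) (clamp_in a b x Hab) eps Heps) as [d [Hd Hdf]].
  exists d; split; [exact Hd|].
  intros y [_ Hy].
  simpl in Hy |- *; unfold Rdist in *.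
  destruct (Req_dec (clamp a b x) (clamp a b y)) as [E|E].
  - rewrite E, Rminus_diag, Rabs_R0; exact Heps.
  - apply Hdf; repeat split; try apply clamp_in; auto.
    simpl; unfold Rdist.
    apply Rle_lt_trans with (2 := Hy), clamp_lipschitz.
Qed.

Lemma IVT_continue_in (a b y : R) (f : R -> R) :
  a <= b -> (forall x, a <= x <= b -> continue_in f (fun y => a <= y <= b) x) ->
  Rmin (f a) (f b) <= y <= Rmax (f a) (f b) ->
  exists x, a <= x <= b /\ f x = y.
Proof.
  intros Hab Hf Hy.
  destruct (IVT_gen (fun x => f (clamp a b x)) a b y) as [x [Hx Hfx]].
  - apply continuity_clamp; assumption.
  - rewrite !clamp_id by lra; exact Hy.
  - rewrite Rmin_left, Rmax_right in Hx by lra.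
    exists x; split; [exact Hx|].
    rewrite clamp_id in Hfx; assumption.
Qed.

(** Continuity extends the inequality to each end point only weakly; strictness is recovered by
    inserting two interior points that cut [[s, t]] into thirds. *)
Lemma incr_closed_of_open (a b : R) (f : R -> R) :
  (forall x, a <= x <= b -> continue_in f (fun y => a <= y <= b) x) ->
  (forall s t, a < s -> s < t -> t < b -> f s < f t) ->
  forall s t, a <= s -> s < t -> t <= b -> f s < f t.
Proof.
  intros Hf Hincr.
  assert (Hl : forall s t, a <= s -> s < t -> t < b -> f s <= f t).
  { intros s t Hs Hst Ht; apply Rnot_lt_le; intros Hlt.
    destruct (Hf s ltac:(lra) (f s - f t) ltac:(lra)) as [d [Hd Hdf]].
    (* [u] lies strictly between [s] and [t], so close to [s] that [f u] still exceeds [f t]. *)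
    set (u := s + Rmin d (t - s) / 2).
    assert (Hm : 0 < Rmin d (t - s)) by (apply Rmin_pos; lra).
    pose proof (Rmin_l d (t - s)); pose proof (Rmin_r d (t - s)).
    assert (Hu : s < u < t) by (unfold u; lra).
    assert (Hd' : Rabs (f u - f s) < f s - f t).
    { apply Hdf; repeat split; try lra.
      simpl; unfold Rdist; rewrite Rabs_pos_eq by lra; unfold u; lra. }
    apply Rabs_def2 in Hd'.
    specialize (Hincr u t); lra. }
  assert (Hr : forall s t, a < s -> s < t -> t <= b -> f s <= f t).
  { intros s t Hs Hst Ht; apply Rnot_lt_le; intros Hlt.
    destruct (Hf t ltac:(lra) (f s - f t) ltac:(lra)) as [d [Hd Hdf]].
    set (u := t - Rmin d (t - s) / 2).
    assert (Hm : 0 < Rmin d (t - s)) by (apply Rmin_pos; lra).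
    pose proof (Rmin_l d (t - s)); pose proof (Rmin_r d (t - s)).
    assert (Hu : s < u < t) by (unfold u; lra).
    assert (Hd' : Rabs (f u - f t) < f s - f t).
    { apply Hdf; repeat split; try lra.
      simpl; unfold Rdist; rewrite Rabs_left by lra; unfold u; lra. }
    apply Rabs_def2 in Hd'.
    specialize (Hincr s u); lra. }
  intros s t Hs Hst Ht.
  apply Rle_lt_trans with (f (s + (t - s) / 3)); [apply Hl; lra|].
  apply Rlt_le_trans with (f (t - (t - s) / 3)); [apply Hincr|apply Hr]; lra.
Qed.

(** * Integration of a monotone slope *)

(** The error bound in a form fit for induction on the subdivision. [g] is nondecreasing but may
    jump, and [U] acts as its antiderivative. The bound [SF_h ptd <= b] is carried along so that the
    hypothesis on increments covers the next cell. *)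
Lemma Riemann_sum_monotone (g U : R -> R) (d : R) (ptd : SF_seq) (b : R) :
  pointed_subdiv ptd -> seq_step (SF_lx ptd) < d ->
  seq.last (SF_h ptd) (SF_lx ptd) = b ->
  (forall s t, SF_h ptd <= s -> s <= t -> t <= b ->
     (t - s) * g s <= U t - U s <= (t - s) * g t) ->
  SF_h ptd <= b /\
  Rabs (Riemann_sum g ptd - (U b - U (SF_h ptd))) <= d * (g b - g (SF_h ptd)).
Proof.
  induction ptd as [x0|[x y] ptd IH] using SF_cons_ind; intros Hptd Hd Hb HU.
  - simpl in *; subst b; split; [lra|].
    unfold Riemann_sum; simpl.
    unfold zero; simpl.
    rewrite !Rminus_diag, Rabs_R0; lra.
  - assert (Hptd' := ptd_cons _ _ Hptd).
    assert (H0 : x <= y <= SF_h ptd).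
    { apply (Hptd 0%nat); rewrite SF_size_cons; lia. }
    rewrite SF_lx_cons in Hd, Hb; simpl fst in *.
    unfold SF_lx, seq_step in Hd; simpl in Hd.
    assert (Hd1 := Rle_lt_trans _ _ _ (Rmax_l _ _) Hd).
    assert (Hd2 := Rle_lt_trans _ _ _ (Rmax_r _ _) Hd).
    rewrite Rabs_pos_eq in Hd1 by lra.
    simpl SF_h in HU |- *.
    destruct IH as [Hle IH]; auto.
    { intros s t Hs; apply HU; lra. }
    split; [lra|].
    rewrite Riemann_sum_cons; simpl fst; simpl snd.
    unfold plus, scal; simpl; unfold mult; simpl.
    pose proof (HU x (SF_h ptd) ltac:(lra) ltac:(lra) ltac:(lra)) as H1.
    pose proof (HU x y ltac:(lra) ltac:(lra) ltac:(lra)) as H2.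
    pose proof (HU y (SF_h ptd) ltac:(lra) ltac:(lra) ltac:(lra)) as H3.
    assert (Hmono : forall s t, x <= s -> s <= t -> t <= b -> g s <= g t).
    { intros s t Hs Hst Ht; destruct (Req_dec s t) as [->|Hne]; [lra|].
      specialize (HU s t ltac:(lra) ltac:(lra) ltac:(lra)); nra. }
    pose proof (Hmono x y ltac:(lra) ltac:(lra) ltac:(lra)).
    pose proof (Hmono y (SF_h ptd) ltac:(lra) ltac:(lra) ltac:(lra)).
    revert IH; generalize (Riemann_sum g ptd); intros S IH.
    apply Rabs_le_between in IH.
    apply Rabs_le; split; nra.
Qed.

(* The Riemann sum error telescopes: on each cell it is at most the mesh times the increment of [g]. *)
Lemma is_RInt_of_increments (g U : R -> R) (a b : R) :
  a <= b ->
  (forall s t, a <= s -> s <= t -> t <= b ->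
     (t - s) * g s <= U t - U s <= (t - s) * g t) ->
  is_RInt g a b (U b - U a).
Proof.
  intros Hab HU.
  destruct Hab as [Hab|Hab].
  2:{ subst b; rewrite Rminus_diag; exact (is_RInt_point g a). }
  assert (Hg : g a <= g b).
  { specialize (HU a b ltac:(lra) ltac:(lra) ltac:(lra)); nra. }
  apply (filterlim_locally (F := Riemann_fine a b)).
  intros eps.
  (* The added 1 keeps the denominator positive when [g a = g b]. *)
  assert (Hd : 0 < eps / (g b - g a + 1)).
  { apply Rdiv_lt_0_compat; [apply cond_pos|lra]. }
  exists (mkposreal _ Hd); simpl.
  intros ptd Hstep [Hptd [Ha Hb]].
  rewrite Rmin_left in Ha by lra; rewrite Rmax_right in Hb by lra.
  destruct (Riemann_sum_monotone g U _ ptd b Hptd Hstep Hb) as [_ H].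
  { rewrite Ha; intros s t Hs; apply HU; lra. }
  rewrite sign_eq_1 by lra.
  change (Rabs (1 * Riemann_sum g ptd - (U b - U a)) < eps).
  rewrite Rmult_1_l.
  rewrite Ha in H.
  apply Rle_lt_trans with (1 := H).
  apply Rlt_le_trans with (eps / (g b - g a + 1) * (g b - g a + 1)); [nra|].
  right; field; lra.
Qed.

(** * The virtual valuation and its inverse *)

Lemma C1_on_continue_in (D : R -> Prop) (g : R -> R) (x : R) :
  C1_on D g -> D x -> continue_in g D x.
Proof.
  intros [dg Hg] Hx.
  apply cont_deriv with dg, Hg, Hx.
Qed.

(** [virtual_capacity] is written with the two-sided [Derive], while the primitives are
    differentiable within [[0, 1]] only. Around an interior point a small enough ball stays in
    [[0, 1]], so the two notions agree. *)
Lemma D_in_interior (f d : R -> R) (x : R) :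
  0 < x < 1 -> D_in f d I01 x -> Derive f x = d x.
Proof.
  intros Hx Hf.
  apply is_derive_unique, is_derive_Reals, derivable_pt_lim_D_in.
  intros eps Heps.
  destruct (Hf eps Heps) as [a [Ha Haf]].
  exists (Rmin a (Rmin x (1 - x))); split.
  { repeat apply Rmin_pos; lra. }
  intros y [[_ Hne] Hy].
  simpl in Hy; unfold Rdist in Hy.
  pose proof (Rmin_l a (Rmin x (1 - x))).
  pose proof (Rmin_r a (Rmin x (1 - x))).
  pose proof (Rmin_l x (1 - x)); pose proof (Rmin_r x (1 - x)).
  apply Haf; split.
  - apply Rabs_lt_between in Hy; split; [unfold I01; lra|exact Hne].
  - simpl; unfold Rdist; lra.
Qed.

(** The integral of the clamped density is differentiable everywhere and coincides with [cdf] on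
    [[0, 1]]. *)
Lemma cdf_continue_in (m : market) (x : R) :
  market_primitives m -> I01 x -> continue_in (cdf m) I01 x.
Proof.
  intros Hm Hx.
  set (fc := fun y => density m (clamp 0 1 y)).
  assert (Hfc : forall y, continuous fc y).
  { intros y; apply continuity_pt_filterlim.
    apply (continuity_clamp 0 1 (density m)); [lra|].
    intros z Hz; apply C1_on_continue_in; [apply density_C1, Hm|exact Hz]. }
  assert (HF : forall y, I01 y -> cdf m y = RInt fc 0 y).
  { intros y Hy; apply RInt_ext; intros z Hz.
    destruct Hy as [Hy0 Hy1].
    rewrite Rmin_left, Rmax_right in Hz by lra.
    unfold fc; rewrite clamp_id; [reflexivity|lra]. }
  assert (Hc : continuity_pt (RInt fc 0) x).
  { apply continuity_pt_filterlim.
    apply (ex_derive_continuous (RInt fc 0) x).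
    exists (fc x); apply is_derive_RInt with 0; [|apply Hfc].
    apply filter_forall; intros y; apply RInt_correct, ex_RInt_continuous.
    intros z _; apply Hfc. }
  intros eps Heps.
  destruct (Hc eps Heps) as [d [Hd Hdc]].
  exists d; split; [exact Hd|].
  intros y [[Hy Hne] Hyd].
  rewrite !HF by assumption.
  apply Hdc; repeat split; assumption.
Qed.

Lemma virtual_valuation_continue_in (m : market) (x : R) :
  market_primitives m -> I01 x -> continue_in (virtual_valuation m) I01 x.
Proof.
  intros Hm Hx.
  apply limit_minus; [apply lim_x|].
  apply limit_mul.
  - apply limit_minus; [apply (limit_free (fun _ => 1) _ x x)|].
    apply cdf_continue_in; assumption.
  - apply limit_inv.
    + apply C1_on_continue_in; [apply density_C1, Hm|exact Hx].
    + apply Rgt_not_eq, (density_pos _ Hm), Hx.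
Qed.

Lemma virtual_valuation_1 (m : market) : market_primitives m -> virtual_valuation m 1 = 1.
Proof.
  intros Hm; unfold virtual_valuation, cdf.
  rewrite (is_RInt_unique _ _ _ _ (density_mass _ Hm)).
  unfold Rdiv; ring.
Qed.

Lemma virtual_valuation_strict_incr (m : market) (theta0 s t : R) :
  market_primitives m -> regular_valuation m theta0 ->
  theta0 <= s -> s < t -> t <= 1 -> virtual_valuation m s < virtual_valuation m t.
Proof.
  intros Hm HG.
  pose proof (theta0_range _ _ HG).
  apply (incr_closed_of_open theta0 1).
  - intros x Hx; apply continue_in_sub with I01; [unfold I01; intros; lra|].
    apply virtual_valuation_continue_in; [exact Hm|unfold I01; lra].
  - apply (valuation_incr _ _ HG).
Qed.

Lemma virtual_valuation_surj (m : market) (theta0 a y : R) :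
  market_primitives m -> regular_valuation m theta0 ->
  theta0 <= a <= 1 -> virtual_valuation m a <= y <= 1 ->
  exists x, a <= x <= 1 /\ virtual_valuation m x = y.
Proof.
  intros Hm HG Ha Hy.
  pose proof (theta0_range _ _ HG).
  apply IVT_continue_in; [lra| |].
  - intros x Hx; apply continue_in_sub with I01; [unfold I01; intros; lra|].
    apply virtual_valuation_continue_in; [exact Hm|unfold I01; lra].
  - rewrite (virtual_valuation_1 m Hm).
    rewrite Rmin_left, Rmax_right by lra; exact Hy.
Qed.

(** [G] runs continuously from 0 at [theta0] to 1 at 1, so the [epsilon] branch has a witness. *)
Lemma virtual_valuation_inv_spec (m : market) (theta0 y : R) :
  market_primitives m -> regular_valuation m theta0 -> 0 <= y <= 1 ->
  theta0 <= virtual_valuation_inv m theta0 y <= 1 /\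
  virtual_valuation m (virtual_valuation_inv m theta0 y) = y.
Proof.
  intros Hm HG Hy.
  unfold virtual_valuation_inv.
  destruct (Rlt_dec 1 y) as [Hlt|_]; [lra|].
  apply (epsilon_spec (inhabits 0)
    (fun theta => theta0 <= theta <= 1 /\ virtual_valuation m theta = y)).
  pose proof (theta0_range _ _ HG).
  apply (virtual_valuation_surj m theta0); auto; [lra|].
  rewrite (theta0_zero _ _ HG); exact Hy.
Qed.

(** * The virtual capacity and its inverse *)

Lemma virtual_capacity_continue_in (m : market) (h0 : Rbar) (h1 q : R) :
  market_primitives m -> regular_capacity m h0 h1 -> 0 < q < 1 ->
  continue_in (virtual_capacity m) (fun y => 0 < y < 1) q.
Proof.
  intros Hm Hh Hq.
  destruct (val_C1 _ Hm) as [dv Hv], (cap_C1 _ Hm) as [dw Hw].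
  assert (HI : forall y, 0 < y < 1 -> I01 y) by (unfold I01; intros; lra).
  assert (Hdv : forall y, 0 < y < 1 -> Derive (val m) y = dv y).
  { intros y Hy; apply D_in_interior; [exact Hy|apply Hv; auto]. }
  assert (Hdw : forall y, 0 < y < 1 -> Derive (cap m) y = dw y).
  { intros y Hy; apply D_in_interior; [exact Hy|apply Hw; auto]. }
  assert (Hc : continue_in (fun y => dw y * / dv y) (fun y => 0 < y < 1) q).
  { apply limit_mul.
    - apply (continue_in_sub I01); [exact HI|apply Hw; auto].
    - apply limit_inv.
      + apply (continue_in_sub I01); [exact HI|apply Hv; auto].
      + rewrite <- Hdv by exact Hq; apply (dval_neq0 _ _ _ Hh), Hq. }
  intros eps Heps.
  destruct (Hc eps Heps) as [d [Hd Hdc]].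
  exists d; split; [exact Hd|].
  intros y Hy; unfold virtual_capacity.
  rewrite !Hdv, !Hdw by (apply Hy || exact Hq).
  apply Hdc, Hy.
Qed.

Lemma virtual_capacity_gt_h1 (m : market) (h0 : Rbar) (h1 q : R) :
  regular_capacity m h0 h1 -> 0 < q < 1 -> h1 < virtual_capacity m q.
Proof.
  intros Hh Hq.
  (* The limit at 1 gives only a weak inequality; comparing through a point between [q] and 1 makes
     it strict. *)
  set (q' := (q + 1) / 2).
  assert (Hq' : q < q' < 1) by (unfold q'; lra).
  apply Rle_lt_trans with (virtual_capacity m q').
  2:{ apply (capacity_decr _ _ _ Hh); lra. }
  apply (filterlim_le (F := at_left 1) (virtual_capacity m)
    (fun _ => virtual_capacity m q') h1 (virtual_capacity m q')).
  - exists (mkposreal (1 - q') ltac:(lra)); simpl.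
    intros y Hy Hy1.
    apply Rabs_lt_between in Hy.
    unfold minus, plus, opp in Hy; simpl in Hy.
    left; apply (capacity_decr _ _ _ Hh); lra.
  - apply (capacity_at1 _ _ _ Hh).
  - apply filterlim_const.
Qed.

Lemma virtual_capacity_lt_h0 (m : market) (h0 : Rbar) (h1 q : R) :
  regular_capacity m h0 h1 -> 0 < q < 1 -> Rbar_lt (virtual_capacity m q) h0.
Proof.
  intros Hh Hq.
  set (q' := q / 2).
  assert (Hq' : 0 < q' < q) by (unfold q'; lra).
  apply Rbar_lt_le_trans with (Finite (virtual_capacity m q')).
  { apply (capacity_decr _ _ _ Hh); lra. }
  apply (filterlim_le (F := at_right 0)
    (fun _ => virtual_capacity m q') (virtual_capacity m) (virtual_capacity m q') h0).
  - exists (mkposreal q' ltac:(lra)); simpl.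
    intros y Hy Hy1.
    apply Rabs_lt_between in Hy.
    unfold minus, plus, opp in Hy; simpl in Hy.
    left; apply (capacity_decr _ _ _ Hh); lra.
  - apply filterlim_const.
  - apply (capacity_at0 _ _ _ Hh).
Qed.

Lemma virtual_capacity_ext_decr (m : market) (h0 : Rbar) (h1 q r : R) :
  regular_capacity m h0 h1 -> I01 q -> I01 r -> q < r ->
  Rbar_lt (virtual_capacity_ext m h0 h1 r) (virtual_capacity_ext m h0 h1 q).
Proof.
  unfold I01; intros Hh Hq Hr Hqr.
  unfold virtual_capacity_ext.
  destruct (Req_EM_T r 0); [lra|].
  destruct (Req_EM_T q 1); [lra|].
  destruct (Req_EM_T q 0), (Req_EM_T r 1).
  (* Both end points are involved here, so some interior value has to separate the two limits. *)
  - apply Rbar_lt_trans with (Finite (virtual_capacity m (1 / 2))).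
    + apply (virtual_capacity_gt_h1 _ _ _ _ Hh); lra.
    + apply (virtual_capacity_lt_h0 _ _ _ _ Hh); lra.
  - apply (virtual_capacity_lt_h0 _ _ _ _ Hh); lra.
  - apply (virtual_capacity_gt_h1 _ _ _ _ Hh); lra.
  - apply (capacity_decr _ _ _ Hh); lra.
Qed.

Lemma virtual_capacity_ext_antitone (m : market) (h0 : Rbar) (h1 q r : R) :
  regular_capacity m h0 h1 -> I01 q -> I01 r -> q <= r ->
  Rbar_le (virtual_capacity_ext m h0 h1 r) (virtual_capacity_ext m h0 h1 q).
Proof.
  intros Hh Hq Hr [Hlt| ->]; [|apply Rbar_le_refl].
  apply Rbar_lt_le, virtual_capacity_ext_decr; assumption.
Qed.

Lemma virtual_capacity_ext_inj (m : market) (h0 : Rbar) (h1 q r : R) :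
  regular_capacity m h0 h1 -> I01 q -> I01 r ->
  virtual_capacity_ext m h0 h1 q = virtual_capacity_ext m h0 h1 r -> q = r.
Proof.
  intros Hh Hq Hr E.
  destruct (Rtotal_order q r) as [Hlt|[Heq|Hlt]]; [exfalso|exact Heq|exfalso];
    apply (virtual_capacity_ext_decr m h0 h1) in Hlt; auto;
    rewrite E in Hlt; exact (Rbar_lt_not_eq _ _ Hlt eq_refl).
Qed.

Lemma virtual_capacity_ext_0 (m : market) (h0 : Rbar) (h1 : R) :
  virtual_capacity_ext m h0 h1 0 = h0.
Proof.
  unfold virtual_capacity_ext; destruct (Req_EM_T 0 0); [reflexivity|lra].
Qed.

Lemma virtual_capacity_ext_1 (m : market) (h0 : Rbar) (h1 : R) :
  virtual_capacity_ext m h0 h1 1 = h1.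
Proof.
  unfold virtual_capacity_ext.
  destruct (Req_EM_T 1 0); [lra|].
  destruct (Req_EM_T 1 1); [reflexivity|lra].
Qed.

(** The extreme values are attained at 1 and 0. For a value strictly between them, the limits of [h]
    supply interior points [a < b] where [h] lies above and below [x]. The intermediate value
    theorem then applies on [[a, b]], even when [h0] is infinite. *)
Lemma virtual_capacity_ext_surj (m : market) (h0 : Rbar) (h1 x : R) :
  market_primitives m -> regular_capacity m h0 h1 ->
  h1 <= x -> Rbar_le x h0 ->
  exists q, I01 q /\ virtual_capacity_ext m h0 h1 q = x.
Proof.
  intros Hm Hh [Hx1|Hx1] Hx0.
  2:{ exists 1; rewrite virtual_capacity_ext_1, Hx1; unfold I01; split; [lra|reflexivity]. }
  apply Rbar_le_lt_or_eq_dec in Hx0; destruct Hx0 as [Hx0|Hx0].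
  2:{ exists 0; rewrite virtual_capacity_ext_0, Hx0; unfold I01; split; [lra|reflexivity]. }
  assert (Ha : exists a, 0 < a < 1 /\ x < virtual_capacity m a).
  { assert (H : at_right 0 (fun y => x < virtual_capacity m y)).
    { apply (capacity_at0 _ _ _ Hh (fun z => x < z)).
      apply (open_Rbar_gt' h0 x), Hx0. }
    destruct H as [d Hd].
    pose proof (cond_pos d).
    assert (Hmin : 0 < Rmin d 1) by (apply Rmin_pos; lra).
    pose proof (Rmin_l d 1); pose proof (Rmin_r d 1).
    exists (Rmin d 1 / 2); split; [lra|].
    apply Hd; [|lra].
    change (Rabs (Rmin d 1 / 2 - 0) < d); rewrite Rabs_pos_eq; lra. }
  assert (Hb : exists b, 0 < b < 1 /\ virtual_capacity m b < x).
  { assert (H : at_left 1 (fun y => virtual_capacity m y < x)).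
    { apply (capacity_at1 _ _ _ Hh (fun z => z < x)).
      apply (open_Rbar_lt' h1 x), Hx1. }
    destruct H as [d Hd].
    pose proof (cond_pos d).
    assert (Hmin : 0 < Rmin d 1) by (apply Rmin_pos; lra).
    pose proof (Rmin_l d 1); pose proof (Rmin_r d 1).
    exists (1 - Rmin d 1 / 2); split; [lra|].
    apply Hd; [|lra].
    change (Rabs (1 - Rmin d 1 / 2 - 1) < d); rewrite Rabs_left; lra. }
  destruct Ha as [a [Ha Hxa]], Hb as [b [Hb Hxb]].
  assert (Hab : a < b).
  { apply Rnot_le_lt; intros [Hba| ->]; [|lra].
    apply (capacity_decr _ _ _ Hh) in Hba; lra. }
  destruct (IVT_continue_in a b x (virtual_capacity m)) as [q [Hq Hqx]].
  - lra.
  - intros y Hy; apply continue_in_sub with (fun y => 0 < y < 1); [intros; lra|].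
    apply virtual_capacity_continue_in with h0 h1; auto; lra.
  - rewrite Rmin_right, Rmax_left by lra; lra.
  - exists q; unfold I01, virtual_capacity_ext; split; [lra|].
    destruct (Req_EM_T q 0); [lra|].
    destruct (Req_EM_T q 1); [lra|].
    rewrite Hqx; reflexivity.
Qed.

Lemma virtual_capacity_inv_sat (m : market) (h0 : Rbar) (h1 : R) (x : Rbar) :
  regular_capacity m h0 h1 -> Rbar_lt h0 x -> virtual_capacity_inv m h0 h1 x = 0.
Proof.
  intros Hh Hx; unfold virtual_capacity_inv.
  destruct (Rbar_lt_dec x h1) as [H|_].
  (* The definition tests against [h1] first; this branch is excluded because [h1 < h0 < x]. *)
  - exfalso.
    assert (H' : Rbar_lt (virtual_capacity_ext m h0 h1 1) (virtual_capacity_ext m h0 h1 0)).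
    { apply virtual_capacity_ext_decr; auto; unfold I01; lra. }
    rewrite virtual_capacity_ext_0, virtual_capacity_ext_1 in H'.
    apply (Rbar_lt_not_eq x x); [|reflexivity].
    apply Rbar_lt_trans with h1; [exact H|].
    apply Rbar_lt_trans with h0; assumption.
  - destruct (Rbar_lt_dec h0 x); [reflexivity|contradiction].
Qed.

Lemma virtual_capacity_inv_spec (m : market) (h0 : Rbar) (h1 x : R) :
  market_primitives m -> regular_capacity m h0 h1 ->
  h1 <= x -> Rbar_le x h0 ->
  I01 (virtual_capacity_inv m h0 h1 x) /\
  virtual_capacity_ext m h0 h1 (virtual_capacity_inv m h0 h1 x) = x.
Proof.
  intros Hm Hh Hx1 Hx0; unfold virtual_capacity_inv.
  destruct (Rbar_lt_dec x h1) as [H|_]; [simpl in H; lra|].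
  destruct (Rbar_lt_dec h0 x) as [H|_].
  { exfalso; apply Rbar_le_not_lt in Hx0; contradiction. }
  apply (epsilon_spec (inhabits 0)
    (fun q => I01 q /\ virtual_capacity_ext m h0 h1 q = x)).
  apply virtual_capacity_ext_surj; assumption.
Qed.

(** [epsilon] returns some class with the same virtual capacity as [q], and injectivity identifies
    it with [q]. *)
Lemma virtual_capacity_inv_ext (m : market) (h0 : Rbar) (h1 q : R) :
  regular_capacity m h0 h1 -> I01 q ->
  virtual_capacity_inv m h0 h1 (virtual_capacity_ext m h0 h1 q) = q.
Proof.
  intros Hh Hq; unfold virtual_capacity_inv; unfold I01 in Hq.
  assert (H1 : Rbar_le h1 (virtual_capacity_ext m h0 h1 q)).
  { rewrite <- (virtual_capacity_ext_1 m h0 h1).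
    apply virtual_capacity_ext_antitone; auto; unfold I01; lra. }
  assert (H0 : Rbar_le (virtual_capacity_ext m h0 h1 q) h0).
  { rewrite <- (virtual_capacity_ext_0 m h0 h1) at 2.
    apply virtual_capacity_ext_antitone; auto; unfold I01; lra. }
  destruct (Rbar_lt_dec _ h1) as [H|_].
  { exfalso; apply Rbar_le_not_lt in H1; contradiction. }
  destruct (Rbar_lt_dec h0 _) as [H|_].
  { exfalso; apply Rbar_le_not_lt in H0; contradiction. }
  assert (H := epsilon_spec (inhabits 0)
    (fun r => I01 r /\ virtual_capacity_ext m h0 h1 r = virtual_capacity_ext m h0 h1 q)
    (ex_intro _ q (conj Hq eq_refl))).
  destruct H as [Hr E].
  apply (virtual_capacity_ext_inj m h0 h1); assumption.
Qed.

Lemma virtual_capacity_inv_p_infty (m : market) (h0 : Rbar) (h1 : R) :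
  regular_capacity m h0 h1 -> virtual_capacity_inv m h0 h1 p_infty = 0.
Proof.
  intros Hh.
  pose proof (h0_pos _ _ _ Hh) as Hpos.
  destruct h0 as [h0| |]; [apply virtual_capacity_inv_sat; simpl; auto| |contradiction].
  (* With [h0] infinite, [p_infty] is itself the value of the extended [h] at 0. *)
  rewrite <- (virtual_capacity_ext_0 m p_infty h1) at 2.
  apply virtual_capacity_inv_ext; [exact Hh|unfold I01; lra].
Qed.

(** * Consequences of incentive compatibility for choices and prices *)

(** Adding the incentive constraints of [s] and [t] against each other gives
    [(t - s) * (v (q t) - v (q s)) >= 0], and [v] is strictly decreasing. *)
Lemma user_choice_antitone (m : market) (Q : R -> Prop) (p q : R -> R) (s t : R) :
  market_primitives m -> strategy Q p -> user_choice m Q p q ->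
  I01 s -> I01 t -> s <= t -> q t <= q s.
Proof.
  intros Hm HQ Hq Hs Ht [Hst| ->]; [|lra].
  destruct (Hq s Hs) as [HQs Hbs], (Hq t Ht) as [HQt Hbt].
  specialize (Hbs _ HQt); specialize (Hbt _ HQs).
  apply Rnot_lt_le; intros Hlt.
  apply (val_decr _ Hm) in Hlt; try (apply (classes_range _ _ HQ); assumption).
  nra.
Qed.

Lemma price_of_choice (m : market) (Q : R -> Prop) (p q : R -> R) (t : R) :
  market_primitives m -> strategy Q p -> user_choice m Q p q -> I01 t ->
  p (q t) = t * val m (q t) - RInt (fun s => val m (q s)) 0 t.
Proof.
  intros Hm HQ Hq Ht.
  set (U := fun s => s * val m (q s) - p (q s)).
  assert (HU0 : U 0 = 0).
  { assert (H0 : I01 0) by (unfold I01; lra).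
    destruct (Hq 0 H0) as [HQ0 Hb0].
    specialize (Hb0 1 (dummy_class _ _ HQ)).
    rewrite (dummy_price _ _ HQ) in Hb0.
    pose proof (price_ge0 _ _ HQ _ HQ0).
    unfold U; lra. }
  (* The mutual incentive constraints of [x] and [y] squeeze the increment of [U] between
     [(y - x) * v (q x)] and [(y - x) * v (q y)]. *)
  assert (HI : is_RInt (fun s => val m (q s)) 0 t (U t - U 0)).
  { apply is_RInt_of_increments; [apply Ht|].
    intros x y Hx Hxy Hy.
    assert (Hx1 : I01 x) by (unfold I01 in *; lra).
    assert (Hy1 : I01 y) by (unfold I01 in *; lra).
    destruct (Hq x Hx1) as [HQx Hbx], (Hq y Hy1) as [HQy Hby].
    specialize (Hbx _ HQy); specialize (Hby _ HQx).
    unfold U; lra. }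
  rewrite (is_RInt_unique _ _ _ _ HI), HU0.
  unfold U; ring.
Qed.

(* By incentive compatibility the increment of [p] is [tau * (increment of v)] for some [tau]
   between the two selected types, so [p' = sel * v']. *)
Lemma C1_on_of_selection (D : R -> Prop) (v p sel : R -> R) :
  C1_on I01 v -> strictly_decreasing_on I01 v -> (forall r, D r -> I01 r) ->
  (forall r, D r -> continue_in sel D r) ->
  (forall r s, D r -> D s -> sel r * (v s - v r) <= p s - p r) ->
  C1_on D p.
Proof.
  intros [dv Hdv] Hv HD Hsel Hp.
  exists (fun r => sel r * dv r); intros r Hr.
  assert (Hd : limit1_in (fun s => (v s - v r) / (s - r)) (D_x D r) (dv r) r).
  { apply (limit1_imp _ (D_x I01 r)); [|apply Hdv, HD, Hr].
    intros s [Hs Hne]; split; auto. }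
  split.
  2:{ apply limit_mul; [apply Hsel, Hr|].
      apply (continue_in_sub I01); [exact HD|apply Hdv, HD, Hr]. }
  assert (Hne : forall s, D_x D r s -> v s - v r <> 0).
  { intros s [Hs Hrs] E.
    destruct (Rtotal_order r s) as [Hlt|[Heq|Hlt]]; [|contradiction|];
      apply Hv in Hlt; auto; lra. }
  assert (Ht : limit1_in (fun s => (p s - p r) / (v s - v r)) (D_x D r) (sel r) r).
  { intros eps Heps.
    destruct (Hsel r Hr eps Heps) as [d [Hd0 Hds]].
    exists d; split; [exact Hd0|].
    intros s [Hs Hsd].
    specialize (Hds s (conj Hs Hsd)).
    simpl in Hds |- *; unfold Rdist in *.
    destruct Hs as [HDs Hrs].
    assert (Hn := Hne s (conj HDs Hrs)).
    pose proof (Hp r s Hr HDs) as H1; pose proof (Hp s r HDs Hr) as H2.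
    set (tau := (p s - p r) / (v s - v r)).
    assert (E : p s - p r = tau * (v s - v r)) by (unfold tau; field; exact Hn).
    rewrite E in H1.
    assert (H2' : sel s * (v s - v r) >= tau * (v s - v r)) by lra.
    apply Rabs_def2 in Hds.
    (* Whichever sign [v s - v r] has, dividing by it places [tau] between [sel r] and [sel s]. *)
    apply Rabs_def1; destruct (Rdichotomy _ _ Hn); nra. }
  apply limit1_ext with (fun s => (p s - p r) / (v s - v r) * ((v s - v r) / (s - r))).
  - intros s Hs.
    assert (Hn := Hne s Hs).
    destruct Hs as [_ Hrs].
    field; split; [lra|exact Hn].
  - apply limit_mul; assumption.
Qed.

(* [sel r] is the first point of [[a, b]] at which the antitone [q] has dropped to [r]; a jump
   of [sel] would come from a plateau of [q], and the only plateau is the last one. *)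
Lemma first_type_continue_in (D : R -> Prop) (q sel : R -> R) (a b r : R) :
  (forall s t, a <= s -> s <= t -> t <= b -> q t <= q s) ->
  (forall s t, a <= s -> s < t -> t <= b -> q s = q t -> q s = q b) ->
  (forall x, D x -> a <= sel x <= b /\ q (sel x) = x /\
     forall t, a <= t <= b -> q t <= x -> sel x <= t) ->
  D r -> continue_in sel D r.
Proof.
  intros Hanti Hflat Hsel Hr eps Heps.
  destruct (Hsel r Hr) as [Ht [Hqt Hfirst]].
  (* Slightly before [sel r] the value of [q] still exceeds [r], by minimality, and this gap serves
     as radius. If that earlier point falls left of [a], the bound [a <= sel x] suffices. *)
  assert (Hlow : exists d, 0 < d /\ forall x, D x -> x < r + d -> sel r - eps < sel x).
  { destruct (Rlt_dec (sel r - eps / 2) a) as [Hl|Hl].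
    - exists 1; split; [lra|].
      intros x Hx _; destruct (Hsel x Hx) as [? _]; lra.
    - assert (Hlt : r < q (sel r - eps / 2)).
      { apply Rnot_le_lt; intros Hle.
        apply Hfirst in Hle; lra. }
      exists (q (sel r - eps / 2) - r); split; [lra|].
      intros x Hx Hxr.
      destruct (Hsel x Hx) as [Hx1 [Hqx _]].
      apply Rnot_le_lt; intros Hle.
      pose proof (Hanti (sel x) (sel r - eps / 2) ltac:(lra) ltac:(lra) ltac:(lra)); lra. }
  (* Slightly after [sel r], either [q] has dropped below [r] and the gap serves as radius, or [q]
     is flat there. In the flat case [r = q b] is the least value of [q], so no [sel x] exceeds
     [sel r]. *)
  assert (Hup : exists d, 0 < d /\ forall x, D x -> r - d < x -> sel x < sel r + eps).
  { destruct (Rlt_dec b (sel r + eps / 2)) as [Hl|Hl].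
    - exists 1; split; [lra|].
      intros x Hx _; destruct (Hsel x Hx) as [? _]; lra.
    - set (t := sel r + eps / 2) in *.
      assert (Htr : sel r < t) by (unfold t; lra).
      destruct (Hanti (sel r) t ltac:(lra) ltac:(lra) ltac:(lra)) as [Hlt|Heq].
      + exists (r - q t); split; [lra|].
        intros x Hx Hxr.
        destruct (Hsel x Hx) as [_ [_ Hx2]].
        specialize (Hx2 t ltac:(lra) ltac:(lra)); unfold t in *; lra.
      + exists 1; split; [lra|].
        intros x Hx _.
        destruct (Hsel x Hx) as [Hx1 [Hqx Hx2]].
        symmetry in Heq.
        pose proof (Hflat (sel r) t ltac:(lra) Htr ltac:(lra) Heq).
        pose proof (Hanti (sel x) b ltac:(lra) ltac:(lra) ltac:(lra)).
        specialize (Hx2 (sel r) Ht ltac:(lra)); lra. }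
  destruct Hlow as [d1 [Hd1 Hl]], Hup as [d2 [Hd2 Hu]].
  exists (Rmin d1 d2); split; [apply Rmin_pos; lra|].
  intros x [[Hx _] Hxd]; simpl in Hxd |- *; unfold Rdist in *.
  pose proof (Rmin_l d1 d2); pose proof (Rmin_r d1 d2).
  apply Rabs_def2 in Hxd.
  specialize (Hl x Hx ltac:(lra)); specialize (Hu x Hx ltac:(lra)).
  apply Rabs_def1; lra.
Qed.

(** * Structure of the optimal choice function *)

(** Several types may share a class where the choice saturates at 0; taking the earliest one singles
    out a type that varies continuously with the class. *)
Definition is_first_type (q : R -> R) (thetahat r t : R) : Prop :=
  thetahat <= t <= 1 /\ q t = r /\
  forall t', thetahat <= t' <= 1 -> q t' <= r -> t <= t'.

(* A negative kappa would make [q] constant equal to 1, hence the capacity used zero, where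
   the slope of the nondecreasing cost cannot be negative. *)
Lemma capacity_price_ge0 (m : market) (theta0 : R) (h0 : Rbar) (h1 : R) (sc : scenario)
    (kappa : R) (q : R -> R) :
  market_primitives m -> regular_capacity m h0 h1 -> admissible_scenario m theta0 sc ->
  (forall t, I01 t -> q t = optimal_choice m theta0 h0 h1 kappa t) ->
  (forall t, I01 t -> I01 (q t)) ->
  (forall s t, I01 s -> I01 t -> s <= t -> q t <= q s) ->
  capacity_price m sc q kappa -> 0 <= kappa.
Proof.
  intros Hm Hh Hsc Hq HI Hanti Hk.
  destruct sc as [CM|cost]; simpl in Hk, Hsc; [lra|].
  apply Rnot_lt_le; intros Hneg.
  assert (I1 : I01 1) by (unfold I01; lra).
  assert (Hq1 : q 1 = 1).
  { rewrite Hq by exact I1; unfold optimal_choice.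
    destruct (Rlt_dec 1 _); [reflexivity|].
    rewrite (virtual_valuation_1 m Hm).
    unfold div_ext; destruct (Req_EM_T kappa 0); [lra|].
    unfold virtual_capacity_inv.
    destruct (Rbar_lt_dec (Finite (1 / kappa)) h1) as [_|H]; [reflexivity|].
    exfalso; apply H; simpl.
    pose proof (h1_ge0 _ _ _ Hh).
    pose proof (Rinv_lt_0_compat _ Hneg).
    unfold Rdiv; lra. }
  assert (HC : capacity_used m q = 0).
  { unfold capacity_used.
    rewrite (RInt_ext _ (fun _ => 0)).
    - rewrite RInt_const; unfold scal; simpl; unfold mult; simpl; ring.
    - intros t Ht; rewrite Rmin_left, Rmax_right in Ht by lra.
      assert (It : I01 t) by (unfold I01; lra).
      pose proof (Hanti t 1 It I1 ltac:(lra)).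
      replace (q t) with 1 by (pose proof (HI t It); unfold I01 in *; lra).
      rewrite (cap_at1 _ Hm); apply Rmult_0_l. }
  rewrite HC in Hk.
  (* The tolerance [- kappa] forces the difference quotient at 0 to be strictly negative for small
     increments. *)
  destruct (Hk (- kappa) ltac:(lra)) as [d [Hd Hlim]].
  assert (Hlt : Rabs ((cost (d / 2) - cost 0) / (d / 2 - 0) - kappa) < - kappa).
  { apply (Hlim (d / 2)); split.
    - split; [unfold nonneg; lra|lra].
    - simpl; unfold Rdist; rewrite Rabs_pos_eq; lra. }
  apply Rabs_def2 in Hlt.
  pose proof (cost_incr _ Hsc 0 (d / 2) ltac:(lra) ltac:(lra)).
  assert (0 <= (cost (d / 2) - cost 0) / (d / 2 - 0)).
  { apply Rmult_le_pos; [lra|].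
    left; apply Rinv_0_lt_compat; lra. }
  lra.
Qed.

(** Three regimes occur. If [kappa * h1 > 1], the marginal user is 1 by convention and a single
    class remains. If [kappa = 0], every type from [thetahat] on receives class 0. Otherwise the
    first type choosing [r] solves [G t = kappa * h r]. *)
Lemma optimal_choice_structure (m : market) (theta0 : R) (h0 : Rbar) (h1 kappa : R)
    (q : R -> R) :
  market_primitives m -> regular_valuation m theta0 -> regular_capacity m h0 h1 ->
  0 <= kappa ->
  (forall t, I01 t -> q t = optimal_choice m theta0 h0 h1 kappa t) ->
  (forall t, I01 t -> I01 (q t)) ->
  (forall s t, I01 s -> I01 t -> s <= t -> q t <= q s) ->
  let thetahat := marginal_user m theta0 h1 kappa in
  theta0 <= thetahat <= 1 /\
  (forall r, q 1 <= r <= q thetahat -> exists t, is_first_type q thetahat r t) /\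
  (forall s t, thetahat <= s -> s < t -> t <= 1 -> q s = q t -> q s = q 1).
Proof.
  intros Hm HG Hh Hk Hq HI Hanti th.
  assert (H0 := theta0_range _ _ HG).
  assert (H1 := h1_ge0 _ _ _ Hh).
  assert (Hkh : 0 <= kappa * h1) by (apply Rmult_le_pos; assumption).
  destruct (Rlt_dec 1 (kappa * h1)) as [Hbig|Hsmall].
  { assert (Hth : th = 1).
    { unfold th, marginal_user, virtual_valuation_inv.
      destruct (Rlt_dec 1 (kappa * h1)); [reflexivity|contradiction]. }
    rewrite Hth; split; [lra|split].
    - intros r Hr; exists 1; repeat split; try lra.
      intros t Ht _; lra.
    - intros s t Hs Hst Ht; lra. }
  destruct (virtual_valuation_inv_spec m theta0 (kappa * h1) Hm HG ltac:(lra)) as [Hth HGth].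
  change (virtual_valuation_inv m theta0 (kappa * h1)) with th in Hth, HGth.
  split; [exact Hth|].
  assert (HIt : forall t, th <= t <= 1 -> I01 t) by (unfold I01; intros; lra).
  assert (Hqt : forall t, th <= t <= 1 ->
    q t = virtual_capacity_inv m h0 h1 (div_ext (virtual_valuation m t) kappa)).
  { intros t Ht; rewrite Hq by auto; unfold optimal_choice.
    fold th; destruct (Rlt_dec t th); [lra|reflexivity]. }
  unfold div_ext in Hqt.
  destruct (Req_EM_T kappa 0) as [Hk0|Hk0].
  { assert (Hz : forall t, th <= t <= 1 -> q t = 0).
    { intros t Ht; rewrite Hqt by exact Ht.
      apply virtual_capacity_inv_p_infty, Hh. }
    split.
    - intros r Hr; rewrite !Hz in Hr by lra.
      exists th; split; [lra|split].
      + rewrite Hz; lra.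
      + intros; lra.
    - intros s t Hs Hst Ht _; rewrite !Hz; lra. }
  assert (Hkpos : 0 < kappa) by lra.
  set (G := virtual_valuation m) in *.
  assert (HGincr : forall s t, th <= s -> s < t -> t <= 1 -> G s < G t).
  { intros s t Hs; apply (virtual_valuation_strict_incr m theta0); auto; lra. }
  set (hx := virtual_capacity_ext m h0 h1).
  assert (Hdiv : forall t, kappa * (G t / kappa) = G t) by (intros; field; exact Hk0).
  (* Either [G t / kappa] overshoots [h0] and the choice saturates at 0, or [q t] genuinely inverts
     the extended [h]. *)
  assert (Hcases : forall t, th <= t <= 1 ->
    (Rbar_lt h0 (G t / kappa) /\ q t = 0) \/ hx (q t) = G t / kappa).
  { intros t Ht.
    destruct (Rbar_lt_dec h0 (G t / kappa)) as [Hlt|Hge]; [left|right].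
    - split; [exact Hlt|].
      rewrite Hqt by exact Ht; apply virtual_capacity_inv_sat; assumption.
    - rewrite Hqt by exact Ht.
      apply (virtual_capacity_inv_spec m h0 h1 (G t / kappa)); auto.
      + apply (Rmult_le_reg_l kappa); [exact Hkpos|].
        rewrite Hdiv.
        destruct (Req_dec th t) as [->|Hne]; [lra|].
        specialize (HGincr th t ltac:(lra) ltac:(lra) ltac:(lra)); lra.
      + apply Rbar_not_lt_le, Hge. }
  assert (Hle0 : forall r, I01 r -> Rbar_le (hx r) h0).
  { intros r Hr; rewrite <- (virtual_capacity_ext_0 m h0 h1).
    apply virtual_capacity_ext_antitone; auto; unfold I01 in *; lra. }
  assert (Hge1 : forall r, I01 r -> Rbar_le h1 (hx r)).
  { intros r Hr; rewrite <- (virtual_capacity_ext_1 m h0 h1).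
    apply virtual_capacity_ext_antitone; auto; unfold I01 in *; lra. }
  assert (Hbound : forall r t, th <= t <= 1 -> I01 r -> q t <= r -> Rbar_le (hx r) (G t / kappa)).
  { intros r t Ht Hr Hqr.
    destruct (Hcases t Ht) as [[Hlt _]|<-].
    - apply Rbar_le_trans with h0; [auto|apply Rbar_lt_le, Hlt].
    - apply virtual_capacity_ext_antitone; auto. }
  split.
  - intros r Hr.
    assert (HIr : I01 r).
    { pose proof (HI 1 (HIt 1 ltac:(lra))); pose proof (HI th (HIt th ltac:(lra))).
      unfold I01 in *; lra. }
    assert (Hy1 := Hge1 r HIr).
    assert (Hy2 := Hbound r 1 ltac:(lra) HIr ltac:(lra)).
    (* The value of the extended [h] at [r] is finite, being caught between [h1] and
       [G 1 / kappa]. *)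
    destruct (hx r) as [y| |] eqn:Hy; simpl in Hy1, Hy2; try contradiction.
    unfold G in Hy2; rewrite (virtual_valuation_1 m Hm) in Hy2; fold G in Hy2.
    assert (Hky : kappa * h1 <= kappa * y <= 1).
    { split; [apply Rmult_le_compat_l; lra|].
      replace 1 with (kappa * (1 / kappa)) by (field; exact Hk0).
      apply Rmult_le_compat_l; lra. }
    destruct (virtual_valuation_surj m theta0 th (kappa * y) Hm HG Hth) as [t [Ht HGt]].
    { fold G; lra. }
    fold G in HGt.
    exists t; split; [exact Ht|split].
    + rewrite Hqt by exact Ht.
      rewrite HGt; replace (kappa * y / kappa) with y by (field; exact Hk0).
      rewrite <- Hy; apply virtual_capacity_inv_ext; assumption.
    (* If [q t' <= r], then [kappa * y <= G t'], that is [G t <= G t'], which a type before [t]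
       would violate. *)
    + intros t' Ht' Hqt'.
      apply Rnot_lt_le; intros Hlt.
      apply HGincr in Hlt; try lra.
      assert (Hb := Hbound r t' Ht' HIr Hqt'); rewrite Hy in Hb; simpl in Hb.
      apply (Rmult_le_compat_l kappa) in Hb; [|lra].
      rewrite Hdiv in Hb; lra.
  - intros s t Hs Hst Ht E.
    (* Without saturation, equal choices would give [G s = G t]. Hence the plateau sits at 0, and
       monotonicity extends it to type 1. *)
    assert (Hz : q s = 0).
    { destruct (Hcases s ltac:(lra)) as [[_ Hz]|Es]; [exact Hz|].
      destruct (Hcases t ltac:(lra)) as [[_ Hz]|Et]; [lra|].
      rewrite <- E, Es in Et; injection Et; intros Et'.
      apply (HGincr s t) in Hst; [|lra|lra].
      apply (f_equal (Rmult kappa)) in Et'; rewrite !Hdiv in Et'; lra. }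
    pose proof (HI 1 (HIt 1 ltac:(lra))).
    pose proof (Hanti s 1 (HIt s ltac:(lra)) (HIt 1 ltac:(lra)) ltac:(lra)).
    unfold I01 in *; lra.
Qed.

Theorem corollary1
  (m : market) (theta0 : R) (h0 : Rbar) (h1 : R)
  (Hm : market_primitives m)
  (HG : regular_valuation m theta0)
  (Hh : regular_capacity m h0 h1)
  (sc : scenario) (Hsc : admissible_scenario m theta0 sc)
  (kappa thetahat : R) (qstar : R -> R)
  (Hthetahat : thetahat = marginal_user m theta0 h1 kappa)
  (Hqstar : forall theta, I01 theta ->
     qstar theta = optimal_choice m theta0 h0 h1 kappa theta)
  (Hkappa : capacity_price m sc qstar kappa)
  (Q : R -> Prop) (p : R -> R)
  (Hopt : optimal_differentiation m sc Q p qstar) :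
  (forall q, service_classes Q qstar thetahat q <-> qstar 1 <= q <= qstar thetahat)
  /\ (forall q vartheta, service_classes Q qstar thetahat q ->
        I01 vartheta -> qstar vartheta = q ->
        p q = vartheta * val m q - RInt (fun s => val m (qstar s)) 0 vartheta)
  /\ C1_on (service_classes Q qstar thetahat) p
  /\ strictly_decreasing_on (service_classes Q qstar thetahat) p.
Proof.
  destruct Hopt as [[HQ [Hq _]] _].
  assert (HI : forall t, I01 t -> I01 (qstar t)).
  { intros t Ht; apply (classes_range _ _ HQ), Hq, Ht. }
  assert (Hanti : forall s t, I01 s -> I01 t -> s <= t -> qstar t <= qstar s).
  { intros s t; apply (user_choice_antitone m Q p qstar); assumption. }
  assert (Hk : 0 <= kappa) by (apply (capacity_price_ge0 m theta0 h0 h1 sc kappa qstar); assumption).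
  destruct (optimal_choice_structure m theta0 h0 h1 kappa qstar) as [Hth [Hfirst Hflat]]; auto.
  rewrite <- Hthetahat in Hth, Hfirst, Hflat.
  assert (H0 := theta0_range _ _ HG).
  assert (HIt : forall t, thetahat <= t <= 1 -> I01 t) by (unfold I01; intros; lra).
  set (D := service_classes Q qstar thetahat).
  (* Monotonicity bounds every class taken up; conversely each value in the interval has a first
     type, whose choice belongs to [Q]. *)
  assert (HD : forall r, D r <-> qstar 1 <= r <= qstar thetahat).
  { intros r; split.
    - intros [_ [t [Ht <-]]].
      split; apply Hanti; try apply HIt; lra.
    - intros Hr; destruct (Hfirst r Hr) as [t [Ht [Hqt _]]].
      split; [rewrite <- Hqt; apply Hq; auto|].
      exists t; split; assumption. }
  assert (HDI : forall r, D r -> I01 r) by (intros r [Hr _]; apply (classes_range _ _ HQ), Hr).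
  set (sel := fun r => epsilon (inhabits 0) (is_first_type qstar thetahat r)).
  assert (Hsel : forall r, D r -> is_first_type qstar thetahat r (sel r)).
  { intros r Hr; apply epsilon_spec, Hfirst, HD, Hr. }
  (* Type [sel r] prefers its own class [r] to [s]. *)
  assert (Hic : forall r s, D r -> D s -> sel r * (val m s - val m r) <= p s - p r).
  { intros r s Hr [Hs _].
    destruct (Hsel r Hr) as [Ht [Hqt _]].
    destruct (Hq (sel r) (HIt _ Ht)) as [_ Hb].
    specialize (Hb s Hs); rewrite Hqt in Hb; lra. }
  split; [exact HD|split; [|split]].
  - intros q vartheta _ Hv <-.
    apply (price_of_choice m Q); assumption.
  - apply (C1_on_of_selection D (val m) p sel); auto; [apply (val_C1 _ Hm)|apply (val_decr _ Hm)|].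
    intros r Hr; apply (first_type_continue_in D qstar sel thetahat 1); auto.
    intros s t Hs Hst Ht; apply Hanti; try apply HIt; lra.
  (* The decrease is strict because [sel s >= thetahat >= theta0 > 0]. *)
  - intros r s Hr Hs Hrs.
    destruct (Hsel s Hs) as [Ht _].
    pose proof (Hic s r Hs Hr).
    pose proof (val_decr _ Hm r s (HDI r Hr) (HDI s Hs) Hrs).
    nra.
Qed.
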